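(* Let $J\subset\mathbb R$ be a closed interval, $\{n_k\}_{k\ge1}$ a sequence of integers with $n_k\ge 2$ for all $k$, and $\{c_k\}_{k\ge 1}$ a sequence with $c_k\in(0,1/n_k]$ for all $k$. If $$\lim_{k\to\infty}\frac{\log c_k}{\log (c_1\cdots c_k)}=0,$$ then for any Moran set $E\in\mathcal M(J,\{n_k\},\{c_k\})$, $$\dim_{qA}E=\lim_{\delta\to0^+}\ \limsup_{q\to\infty}\ \max_{1\le p\le l_{q,\delta}}\frac{\log(n_p\cdots n_q)}{-\log(c_p\cdots c_q)},$$ where, for $\delta\in(0,1)$ and $q\ge1$, $l_{q,\delta}=\max\left\{1\le p\le q:\ \frac{\log(c_p\cdots c_q)}{\log(c_1\cdots c_q)}>\delta\right\}$. In particular, if $\inf_{k\ge1}c_k>0$, then for any $E\in\mathcal M(J,\{n_k\},\{c_k\})$, $$\dim_{qA}E=\lim_{\eta\to0^+}\ \limsup_{q\to\infty}\ \max_{1\le p\le q(1-\eta)}\frac{\log(n_p\cdots n_q)}{-\log(c_p\cdots c_q)}.$$ Here $p,q$ range over positive integers.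
   Context: Moran sets: let $J\subset\mathbb R$ be a (bounded, nondegenerate) closed interval, $n_k\ge2$ integers and $c_k\in(0,1/n_k]$ for $k\ge1$. Let $\mathcal D^k=\{i_1\cdots i_k: i_t\in\mathbb N\cap[1,n_t]\text{ for all }t\}$ and $\mathcal D^0=\{\emptyset\}$ (empty word), $J_\emptyset=J$. Suppose that for every $k\ge1$ and every $i_1\cdots i_{k-1}\in\mathcal D^{k-1}$, $J_{i_1\cdots i_{k-1}1},\dots,J_{i_1\cdots i_{k-1}n_k}$ are closed subintervals of $J_{i_1\cdots i_{k-1}}$ with pairwise disjoint interiors such that $|J_{i_1\cdots i_{k-1}j}|/|J_{i_1\cdots i_{k-1}}|=c_k$ for all $1\le j\le n_k$ (where $|\cdot|$ is length). Their relative positions are otherwise arbitrary (and may vary with the word; adjacent ones may share an endpoint). The compact set $F=\bigcap_{k=0}^\infty\bigcup_{i_1\cdots i_k\in\mathcal D^k}J_{i_1\cdots i_k}$ is called a Moran set with structure $(J,\{n_k\},\{c_k\})$, and $\mathcal M(J,\{n_k\},\{c_k\})$ denotes the class of all such sets. Quasi-Assouad dimension: for a metric space $X$ and $0<r<R$, $N_{r,R}(X)$ is the smallest number of closed balls of radius $r$ needed to cover any closed ball of radius $R$ in $X$, i.e. the least $N$ such that every closed ball of radius $R$ in $X$ can be covered by $N$ closed balls of radius $r$ in $X$. For $\delta\in(0,1)$ let $$h_X(\delta)=\inf\{\alpha\ge 0:\exists\, b,c>0 \text{ such that } N_{r,R}(X)\le c(R/r)^\alpha \text{ for all } r,R \text{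 with } 0<r<r^{1-\delta}\le R<b\},$$ and $\dim_{qA}X=\lim_{\delta\to 0^+}h_X(\delta)$ (the limit exists because $h_X(\delta)$ is monotone in $\delta$). Subsets of $\mathbb R$ carry the Euclidean metric. *)

(* Defs.v *)
From HB Require Import structures.
From mathcomp Require Import all_boot all_order all_algebra.
From mathcomp Require Import all_classical all_reals all_analysis.
Set Implicit Arguments.
Unset Strict Implicit.
Unset Printing Implicit Defensive.
Import Order.TTheory GRing.Theory Num.Theory numFieldNormedType.Exports.
Local Open Scope classical_set_scope.
Local Open Scope ring_scope.

(* A metric space X is given as a subset of a metricType M, with the induced
   distance; take X = setT for M itself.  The centers of the balls lie in X. *)
Section quasi_assouad_dimension.
Context {R : realType} {M : metricType R}.
Implicit Types (X : set M) (r rho delta alpha : R).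

(* Not the library's closed_ball, which is the closure of the open ball. *)
Definition mclosed_ball X (x : M) r : set M := [set y | X y /\ mdist x y <= r].

Definition covered_by X (A : set M) (N : nat) r : Prop :=
  exists s : seq M, [/\ size s = N, (forall x, x \in s -> X x) &
    A `<=` \bigcup_(x in [set` s]) mclosed_ball X x r].

(* +oo when no finite N works. *)
Definition covering_number X r rho : \bar R :=
  ereal_inf [set N%:R%:E | N in
    [set N : nat | forall x, X x -> covered_by X (mclosed_ball X x rho) N r]].

Definition qA_exponent X delta : \bar R :=
  ereal_inf [set alpha%:E | alpha in [set alpha | 0 <= alpha /\
    exists b c, [/\ 0 < b, 0 < c & forall r rho,
      0 < r -> r < r `^ (1 - delta) -> r `^ (1 - delta) <= rho -> rho < b ->
      (covering_number X r rho <= (c * (rho / r) `^ alpha)%:E)%E]]].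

Definition dim_qA X : \bar R := lim (qA_exponent X delta @[delta --> 0^'+]).

(* The limit defining dim_qA always exists. *)
Lemma qA_exponent_is_cvg X : cvg (qA_exponent X delta @[delta --> 0^'+]).
Proof.
apply: nonincreasing_at_right_is_cvge; apply: nearW => x d e.
rewrite !in_itv/= => /andP[d0 _] _ de.
apply: ereal_inf_le_tmp => _ [alpha [a0 [b [c [b0 c0 H]]]] <-].
exists alpha => //; split => //; exists (Num.min b 1), c.
split => //; first by rewrite lt_min b0 ltr01.
move=> r rho r0 rlt rle; rewrite lt_min => /andP[rhob rho1].
have r1 : r < 1 by rewrite (lt_trans rlt)// (le_lt_trans rle).
have lnr : ln r < 0 by rewrite ln_lt0// r0.
apply: H => //.
- rewrite -[ltLHS](powRr1 (ltW r0)) /powR gt_eqF// ltr_expR.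
  by rewrite ltr_nM2r// ltrBlDr ltrDl.
- apply: le_trans rle; rewrite /powR gt_eqF// ler_expR.
  by rewrite ler_nM2r// lerB.
Qed.

End quasi_assouad_dimension.

(* n and c are indexed from 1; their values at 0 play no role. *)
Section moran_sets.
Context {R : realType}.
Implicit Types (a b delta eta : R) (n : nat -> nat) (c : nat -> R).

Definition words n (k : nat) : set (seq nat) :=
  [set w | size w = k /\
           forall t, (t < k)%N -> (1 <= nth 0%N w t <= n t.+1)%N].

Definition basic_itv (lo hi : seq nat -> R) (w : seq nat) : set R :=
  [set` `[lo w, hi w]].

(* rcons w j is the word w followed by the letter j. *)
Definition moran_intervals a b n c (lo hi : seq nat -> R) : Prop :=
  [/\ lo [::] = a, hi [::] = b &
    forall (k : nat) (w : seq nat), words n k w ->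
      (forall j : nat, (1 <= j <= n k.+1)%N ->
        [/\ lo (rcons w j) <= hi (rcons w j),
            basic_itv lo hi (rcons w j) `<=` basic_itv lo hi w &
            (hi (rcons w j) - lo (rcons w j)) / (hi w - lo w) = c k.+1]) /\
      (forall i j : nat, (1 <= i <= n k.+1)%N -> (1 <= j <= n k.+1)%N ->
        i <> j ->
        (basic_itv lo hi (rcons w i))° `&` (basic_itv lo hi (rcons w j))°
          = set0)].

(* The class of Moran sets with structure (`[a, b], n, c). *)
Definition moran_class a b n c : set (set R) :=
  [set E | exists lo hi, moran_intervals a b n c lo hi /\
    E = \bigcap_k \bigcup_(w in words n k) basic_itv lo hi w].

Definition log_ratio n c (p q : nat) : R :=
  ln (\prod_(p <= i < q.+1) (n i)%:R) / - ln (\prod_(p <= i < q.+1) c i).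

(* The defining set contains p = 1 when 1 <= q and delta < 1. *)
Definition ell c (q : nat) delta : nat :=
  \max_(1 <= p < q.+1 |
    delta < ln (\prod_(p <= i < q.+1) c i) / ln (\prod_(1 <= i < q.+1) c i)) p.

End moran_sets.

(* Main.v *)
(* Write A k = log (n_1 ... n_k) and L k = - log (c_1 ... c_k).  A level-p basic
   interval has length |J| exp (- L p) and contains exp (A q - A p) basic
   intervals of level q, whose left endpoints are at least |J| exp (- L q)
   apart.  Hence, up to a factor 4, exp (A q - A p) balls of radius
   |J| exp (- L q) are necessary and sufficient to cover a ball of radius
   |J| exp (- L p).  Let S delta be the limsup of the statement and h delta the
   exponent in the definition of the quasi-Assouad dimension.  The lower bound
   on covering numbers gives S delta <= h (delta / 2).  For arbitrary radii
   r < rho, comparison with the nearest levels costs log c_p and log c_q, which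
   the hypothesis makes negligible with respect to L q, and L q is at most a
   multiple of log (rho / r); this gives h delta <= S (delta / 2).  As S is
   monotone it converges at 0+, and h is squeezed to the same limit.  When
   inf c_k > 0, L q - L p is comparable to q - p, so that the constraints
   p <= q (1 - eta) and p <= l_(q, delta) are interchangeable up to rescaling
   eta. *)
Require Import Defs.
From mathcomp Require Import all_boot all_order all_algebra.
From mathcomp Require Import all_classical all_reals all_analysis.
From mathcomp Require Import ring lra.
Set Implicit Arguments.
Unset Strict Implicit.
Unset Printing Implicit Defensive.
Import Order.TTheory GRing.Theory Num.Theory numFieldNormedType.Exports.
Local Open Scope classical_set_scope.
Local Open Scope ring_scope.

Lemma prod_nat_gt0 (R : realType) (f : nat -> R) (p q : nat) :
  (forall k, (1 <= k)%N -> 0 < f k) -> (1 <= p)%N ->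
  0 < \prod_(p <= i < q) f i.
Proof.
move=> f0 p1; rewrite big_nat; apply: prodr_gt0 => i /andP[pi _].
exact/f0/(leq_trans p1).
Qed.

(** The distance is known through its open balls only; two reals with the same strict upper bounds
    are equal. *)
Lemma mdistE (R : realType) (x y : R^o) : mdist x y = `|x - y|.
Proof.
have ballE d : (mdist x y < d) = (`|x - y| < d).
  by apply/idP/idP; have := ballEmdist x d; rewrite -ball_normE /ball_ =>
    /(congr1 (@^~ y))/= ->.
by apply/eqP; rewrite eq_le !leNgt -ballE ltxx ballE ltxx.
Qed.

(** * Counting basic intervals *)

(** Cut the range into [K] half-open cells of length [l]. By separation no cell holds two values of
    [f], so the cell index [g] is injective on [s]. *)
Lemma packing (R : realType) (T : eqType) (s : seq T) (f : T -> R) (u l : R)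
    (K : nat) : 0 < l -> uniq s ->
  {in s &, forall x y, x != y -> f x + l <= f y \/ f y + l <= f x} ->
  {in s, forall x, u <= f x < u + K%:R * l} -> (size s <= K)%N.
Proof.
move=> l0 us sep rng; pose g x := Num.truncn ((f x - u) / l).
have g0 x : x \in s -> 0 <= (f x - u) / l.
  by move=> /rng /andP[ux _]; rewrite divr_ge0 ?subr_ge0// ltW.
rewrite -(size_map g) -(size_iota 0 K); apply: uniq_leq_size.
  rewrite map_inj_in_uniq// => x y xs ys gxy; apply/eqP/negPn/negP => xy.
  have /andP[x1 x2] := truncn_itv (g0 _ xs).
  have /andP[y1 y2] := truncn_itv (g0 _ ys).
  rewrite -/(g x) -/(g y) -natr1 gxy in x1 x2 y1 y2.
  rewrite -natr1 in y2.
  rewrite !ler_pdivlMr// !ltr_pdivrMr// in x1 x2 y1 y2.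
  by have [h|h] := sep _ _ xs ys xy; lra.
move=> _ /mapP[x xs ->]; rewrite mem_iota/= add0n truncn_lt_nat ?g0//.
by have /andP[_ h] := rng _ xs; rewrite ltr_pdivrMr// ltrBlDl.
Qed.

(** * Words and their descendants *)

Section words.
Variable n : nat -> nat.

Lemma words_rcons k w j :
  words n k.+1 (rcons w j) <-> words n k w /\ (1 <= j <= n k.+1)%N.
Proof.
rewrite /words/= size_rcons; split=> [[[sw] h]|[[sw h] hj]].
  split; last by have := h k (ltnSn k); rewrite nth_rcons sw ltnn eqxx.
  by split=> // t tk; have := h t (ltnW tk); rewrite nth_rcons sw tk.
split=> [|t]; first by rewrite sw.
rewrite ltnS leq_eqVlt => /predU1P[->|tk]; rewrite nth_rcons sw.
  by rewrite ltnn eqxx.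
by rewrite tk; exact: h.
Qed.

Lemma words_rconsP k w : words n k.+1 w ->
  exists u j, [/\ w = rcons u j, words n k u & (1 <= j <= n k.+1)%N].
Proof.
case/lastP: w => [[]//|u j /words_rcons[uw jn]].
by exists u, j.
Qed.

Lemma words_take k m w : words n m w -> (k <= m)%N -> words n k (take k w).
Proof.
move=> [sw h] km; split; first by rewrite size_takel// sw.
by move=> t tk; rewrite nth_take//; apply: h; exact: leq_trans km.
Qed.

Lemma words_pad k m w : (forall i, (1 <= i)%N -> (2 <= n i)%N) ->
  words n k w -> words n (k + m) (w ++ nseq m 1%N).
Proof.
move=> n2 [sw h]; split; first by rewrite size_cat size_nseq sw.
move=> t tkm; rewrite nth_cat sw; case: (ltnP t k) => [|kt]; first exact: h.
rewrite nth_nseq ltn_subLR// tkm /=.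
by apply: ltnW; exact: n2.
Qed.

(** A list rather than a set, so that [size] and [uniq] do the counting. Here [k] is the common
    length of the words of [s], which fixes the alphabets of the [m] letters to be appended. *)
Fixpoint extensions (k : nat) (s : seq (seq nat)) (m : nat) : seq (seq nat) :=
  if m is m'.+1 then
    [seq rcons w j | w <- extensions k s m', j <- iota 1 (n (k + m').+1)]
  else s.

Lemma size_extensions k s m :
  size (extensions k s m) = (size s * \prod_(k.+1 <= i < (k + m).+1) n i)%N.
Proof.
elim: m => [|m IH] /=; first by rewrite addn0 big_geq ?muln1.
rewrite size_allpairs IH size_iota addnS -mulnA; congr (_ * _)%N.
by rewrite [RHS]big_nat_recr//= ltnS leq_addr.
Qed.

Lemma uniq_extensions k s m : uniq s -> uniq (extensions k s m).
Proof.
move=> us; elim: m => [//|m IH] /=; apply: allpairs_uniq => //.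
  exact: iota_uniq.
by move=> [w i] [v j] _ _ /= /rcons_inj[-> ->].
Qed.

Lemma extensions_words k s m : (forall w, w \in s -> words n k w) ->
  forall w, w \in extensions k s m ->
  words n (k + m) w /\ take k w \in s.
Proof.
move=> sk; elim: m => [|m IH] w /=.
  move=> ws; have ww := sk _ ws; rewrite addn0; split=> //.
  by case: ww => sw _; rewrite -sw take_size.
move=> /allpairsP[[v j] /= [/IH[vw tv] hj ->]].
rewrite addnS; split.
  by apply/words_rcons; split=> //; rewrite mem_iota add1n ltnS in hj.
by rewrite -cats1 takel_cat//; case: vw => -> _; exact: leq_addr.
Qed.

Lemma mem_extensions k s m w : words n (k + m) w -> take k w \in s ->
  w \in extensions k s m.
Proof.
elim: m w => [|m IH] w /=.
  by rewrite addn0 => -[sw _]; rewrite -{1}sw take_size.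
rewrite addnS => /words_rconsP[u [j [-> uw hj]]] tw.
apply/allpairsP; exists (u, j); split=> //=; last first.
  by rewrite mem_iota add1n ltnS.
apply: IH => //; move: tw; rewrite -cats1 takel_cat//.
by case: uw => -> _; exact: leq_addr.
Qed.

End words.

(** * Geometry of basic intervals and covering bounds *)

Section moran_intervals_theory.
Context {R : realType}.
Variables (a b : R) (n : nat -> nat) (c : nat -> R) (lo hi : seq nat -> R).
Hypothesis ab : a < b.
Hypothesis n_ge2 : forall k : nat, (1 <= k)%N -> (2 <= n k)%N.
Hypothesis c_gt0 : forall k : nat, (1 <= k)%N -> 0 < c k.
Hypothesis mor : moran_intervals a b n c lo hi.

Let E : set R^o := \bigcap_k \bigcup_(w in words n k) basic_itv lo hi w.

Definition level_length k := (b - a) * \prod_(1 <= i < k.+1) c i.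

Lemma level_length_gt0 k : 0 < level_length k.
Proof. by rewrite mulr_gt0 ?subr_gt0// prod_nat_gt0. Qed.

Lemma length_basic_itv k w : words n k w -> hi w - lo w = level_length k.
Proof.
case: mor => loa hib step; elim: k w => [|k IH] w.
  by move=> [/size0nil -> _]; rewrite loa hib /level_length big_geq ?mulr1.
move=> /words_rconsP[u [j [-> uw hj]]].
have [/(_ j hj)[_ _ h] _] := step _ _ uw.
move: h; rewrite (IH _ uw) => /(canRL (mulfVK (lt0r_neq0 (level_length_gt0 k)))).
by move=> ->; rewrite /level_length [in RHS]big_nat_recr//= mulrC mulrA.
Qed.

Lemma lo_lt_hi k w : words n k w -> lo w < hi w.
Proof. by move=> /length_basic_itv h; rewrite -subr_gt0 h level_length_gt0. Qed.

Lemma basic_itv_rcons k w j : words n k w -> (1 <= j <= n k.+1)%N ->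
  lo w <= lo (rcons w j) /\ hi (rcons w j) <= hi w.
Proof.
case: mor => _ _ step ww hj; have [/(_ j hj)[h1 h2 _] _] := step _ _ ww.
split.
  have : lo (rcons w j) \in `[lo (rcons w j), hi (rcons w j)].
    by rewrite in_itv/= lexx.
  by move=> /h2; rewrite /basic_itv/= in_itv/= => /andP[].
have : hi (rcons w j) \in `[lo (rcons w j), hi (rcons w j)].
  by rewrite in_itv/= h1 lexx.
by move=> /h2; rewrite /basic_itv/= in_itv/= => /andP[].
Qed.

Lemma basic_itv_take k m w : words n m w -> (k <= m)%N ->
  lo (take k w) <= lo w /\ hi w <= hi (take k w).
Proof.
elim: m w => [|m IH] w ww.
  by case: (ww) => sw _; rewrite leqn0 => /eqP ->; rewrite (size0nil sw).
rewrite leq_eqVlt => /predU1P[->|].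
  by case: (ww) => sw _; rewrite -sw take_size.
rewrite ltnS => km; have [u [j [-> uw hj]]] := words_rconsP ww.
have [l1 h1] := basic_itv_rcons uw hj; have [l2 h2] := IH _ uw km.
rewrite -cats1 takel_cat; last by case: uw => -> _.
by rewrite cats1; split; [exact: le_trans l1|exact: le_trans h2].
Qed.

(** Words with different parents inherit the order of the parents. Siblings overlapping in more than
    a point would share the midpoint of the overlap, against the disjointness of interiors. *)
Lemma basic_itv_sep k w v : words n k w -> words n k v -> w != v ->
  hi w <= lo v \/ hi v <= lo w.
Proof.
elim: k w v => [|k IH] w v.
  by move=> [/size0nil -> _] [/size0nil -> _]; rewrite eqxx.
move=> ww vw wv; have [wlt vlt] := (lo_lt_hi ww, lo_lt_hi vw).
have [u [i [wE uw hi_]]] := words_rconsP ww.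
have [u' [j [vE uw' hj]]] := words_rconsP vw.
have [uu'|uu'] := eqVneq u u'; last first.
  have [l1 h1] := basic_itv_rcons uw hi_; have [l2 h2] := basic_itv_rcons uw' hj.
  rewrite -wE in l1 h1; rewrite -vE in l2 h2.
  by have [h|h] := IH _ _ uw uw' uu'; [left|right]; lra.
subst u'; have ij : i <> j by move=> ij; move: wv; rewrite wE vE ij eqxx.
case: mor => _ _ step; have [_ /(_ i j hi_ hj ij)] := step _ _ uw.
rewrite /basic_itv -wE -vE !interior_itv => dis.
case: (leP (hi w) (lo v)) => [|h1]; first by left.
case: (leP (hi v) (lo w)) => [|h2]; first by right.
exfalso; have ML : Num.max (lo w) (lo v) < Num.min (hi w) (hi v).
  by rewrite gt_max !lt_min wlt vlt h1 h2.
have [m1 m2] := midf_lt ML.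
suff : set0 ((Num.max (lo w) (lo v) + Num.min (hi w) (hi v)) / 2) by [].
rewrite -dis; move: m1 m2; rewrite gt_max lt_min => /andP[m1 m2] /andP[m3 m4].
by split; rewrite /= in_itv/= ?m1 ?m2 ?m3 ?m4.
Qed.

Lemma lo_sep k w v : words n k w -> words n k v -> w != v ->
  lo w + level_length k <= lo v \/ lo v + level_length k <= lo w.
Proof.
move=> ww vw wv; have := basic_itv_sep ww vw wv.
have := length_basic_itv ww; have := length_basic_itv vw.
by move=> ? ? [?|?]; [left|right]; lra.
Qed.

(** Nested intervals: always descend to the child numbered 1; the supremum of the left endpoints
    lies in every interval of the chain. *)
Lemma moran_meets_basic_itv k w : words n k w ->
  exists x, E x /\ lo w <= x <= hi w.
Proof.
move=> ww; pose W m := w ++ nseq m 1%N.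
have Ww m : words n (k + m) (W m) by exact: words_pad.
have takeW m p : (p <= m)%N -> take (k + p) (W m) = W p.
  move=> pm; case: (ww) => sw _; rewrite /W take_cat sw ltnNge leq_addr/= addKn.
  by rewrite take_nseq.
have nest m p : lo (W m) <= hi (W p).
  have [mp|/ltnW pm] := leqP m p.
    have [h _] := basic_itv_take (Ww p) (leq_add (leqnn k) mp).
    by rewrite takeW// in h; apply: le_trans h (ltW (lo_lt_hi (Ww p))).
  have [_ h] := basic_itv_take (Ww m) (leq_add (leqnn k) pm).
  by rewrite takeW// in h; apply: le_trans (ltW (lo_lt_hi (Ww m))) h.
pose A := [set lo (W m) | m in setT].
have A0 : A !=set0 by exists (lo (W 0)); exists 0%N.
have ubA p : ubound A (hi (W p)) by move=> _ [m _ <-].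
have supW p : lo (W p) <= sup A <= hi (W p).
  apply/andP; split; last exact: ge_sup.
  by apply: ub_le_sup; [exists (hi (W 0%N)); exact: ubA|exists p].
exists (sup A); split; last by have := supW 0%N; rewrite /W/= cats0.
(* [W p] has length [k + p], so its prefix of length [p] is a word of level [p], and its interval
   contains that of [W p]. *)
move=> p _; exists (take p (W p)).
  by apply: words_take (Ww p) _; exact: leq_addl.
rewrite /basic_itv/= in_itv/=.
have [l h] := basic_itv_take (Ww p) (leq_addl k p).
have /andP[h1 h2] := supW p.
by rewrite (le_trans l h1)/= (le_trans h2 h).
Qed.

(** Centre the large ball at a point of [E] in the interval of the word [1...1], which it then
    contains. Each descendant of that interval at level [k + m] contains a point of [E], and each
    small ball serves at most 4 descendants. *)
Lemma prod_le_covered k m (rho r : R) (N : nat) :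
  level_length k <= rho -> 0 <= r <= level_length (k + m) ->
  (forall x, E x -> Defs.covered_by E (mclosed_ball E x rho) N r) ->
  (\prod_(k.+1 <= i < (k + m).+1) n i <= 4 * N)%N.
Proof.
move=> hrho /andP[r0 hr] cov.
pose v : seq nat := nseq k 1%N.
have vw : words n k v.
  have [|sv hv] := @words_pad n 0 k [::] n_ge2.
    by split.
  by split.
have [x [Ex /andP[x1 x2]]] := moran_meets_basic_itv vw.
have [s [sN sE cover]] := cov _ Ex.
pose X := extensions n k [:: v] m.
have wX w : w \in X -> words n (k + m) w /\ take k w = v.
  move=> /(@extensions_words n k [:: v] m) [|? ].
    by move=> ?; rewrite inE => /eqP ->.
  by rewrite inE => /eqP.
have uX : uniq X by exact: uniq_extensions.
(* An interval of level [k + m] meeting the ball around [z] has its left endpoint in this window, of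
   length at most three level lengths; [packing] with half-open cells then gives 4. *)
pose close z w := (z - r - level_length (k + m) <= lo w) && (lo w <= z + r).
have Xs : {subset X <= flatten [seq [seq w <- X | close z w] | z <- s]}.
  move=> w Xw; have [ww tw] := wX _ Xw.
  have [y [Ey /andP[y1 y2]]] := moran_meets_basic_itv ww.
  have [] := basic_itv_take ww (leq_addr m k); rewrite tw => lw hw.
  have : mclosed_ball E x rho y.
    split=> //; rewrite mdistE ler_distl.
    have := length_basic_itv vw => ?.
    by apply/andP; split; lra.
  move=> /cover[z /= zs [_]]; rewrite mdistE ler_distl.
  move=> /andP[z1 z2]; apply/flattenP; exists ([seq w <- X | close z w]).
    by apply/mapP; exists z.
  rewrite mem_filter Xw andbT; have := length_basic_itv ww => ?.
  by rewrite /close; apply/andP; split; lra.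
have := uniq_leq_size uX Xs; rewrite size_extensions mul1n => /leq_trans; apply.
rewrite size_flatten /shape -map_comp -sN.
have {sN sE cover Xs} : {in s, forall z, (size ([seq w <- X | close z w]) <= 4)%N}.
  move=> z _; apply: (@packing R _ _ lo (z - r - level_length (k + m))
    (level_length (k + m))).
  - exact: level_length_gt0.
  - exact: filter_uniq.
  - move=> w w'; rewrite !mem_filter => /andP[_ /wX[ww _]] /andP[_ /wX[ww' _]].
    exact: lo_sep.
  - move=> w; rewrite mem_filter => /andP[/andP[n1 n2] _].
    rewrite n1/=; apply: (le_lt_trans n2).
    by have := level_length_gt0 (k + m); lra.
elim: s => [//|z s IH] h /=; rewrite mulnS leq_add//.
  by apply: h; rewrite mem_head.
by apply: IH => y ys; apply: h; rewrite inE ys orbT.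
Qed.

(** The large ball meets at most 4 intervals of level [k]. Each of their descendants at level
    [k + m] is covered by one ball of radius [r] around a point of [E] chosen in it. *)
Lemma covered_by_prod k m (rho r : R) (x : R) : E x ->
  rho <= level_length k -> level_length (k + m) <= r ->
  Defs.covered_by E (mclosed_ball E x rho)
    (4 * \prod_(k.+1 <= i < (k + m).+1) n i) r.
Proof.
move=> Ex hrho hr.
pose l := level_length k; have l0 : 0 < l := level_length_gt0 k.
pose close v := (x - l - l <= lo v) && (lo v <= x + l).
pose W := extensions n 0 [:: [::]] k.
have wW w : w \in W -> words n k w.
  move=> /(@extensions_words n 0 [:: [::]] k) [|//].
  by move=> ?; rewrite inE => /eqP ->; split.
pose V := [seq w <- W | close w].
have uV : uniq V by apply: filter_uniq; exact: uniq_extensions.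
have V4 : (size V <= 4)%N.
  apply: (@packing R _ _ lo (x - l - l) l) => //.
  - move=> w w'; rewrite !mem_filter => /andP[_ /wW ww] /andP[_ /wW ww'].
    exact: lo_sep.
  - move=> w; rewrite mem_filter => /andP[/andP[n1 n2] _].
    by rewrite n1/=; lra.
pose X := extensions n k V m.
have wX w : w \in X -> words n (k + m) w.
  move=> /(@extensions_words n k V m) [|//].
  by move=> ?; rewrite mem_filter => /andP[_ /wW].
have [z zP] : {z : seq nat -> R & forall w, words n (k + m) w ->
    E (z w) /\ lo w <= z w <= hi w}.
  apply: (@choice _ _ (fun w z => words n (k + m) w ->
    E z /\ lo w <= z <= hi w)) => w.
  case: (pselect (words n (k + m) w)) => [ww|nw].
    by have [y yP] := moran_meets_basic_itv ww; exists y.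
  by exists 0.
have szX : (size X <= 4 * \prod_(k.+1 <= i < (k + m).+1) n i)%N.
  by rewrite size_extensions leq_mul2r V4 orbT.
(* Copies of [x] pad the list, since [covered_by] asks for an exact number of centres. *)
exists ([seq z w | w <- X] ++
  nseq (4 * \prod_(k.+1 <= i < (k + m).+1) n i - size X) x); split.
- by rewrite size_cat size_map size_nseq subnKC.
- move=> y; rewrite mem_cat => /orP[/mapP[w /wX /zP[Ez _] ->]//|].
  by rewrite mem_nseq => /andP[_ /eqP ->].
- move=> y [Ey]; rewrite mdistE ler_distl => /andP[y1 y2].
  have [w ww] := Ey (k + m)%N I; rewrite /basic_itv/= in_itv/= => /andP[w1 w2].
  have [Ez /andP[z1 z2]] := zP _ ww.
  exists (z w) => /=; last first.
    split=> //; rewrite mdistE ler_distl.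
    have := length_basic_itv ww => ?.
    by apply/andP; split; lra.
  rewrite mem_cat; apply/orP; left; apply/map_f/mem_extensions => //.
  have tw := words_take ww (leq_addr m k).
  rewrite mem_filter; apply/andP; split.
    have [h1 h2] := basic_itv_take ww (leq_addr m k).
    have := length_basic_itv tw; rewrite -/l in hrho * => ?.
    by rewrite /close; apply/andP; split; lra.
  by apply: mem_extensions => //; rewrite take0 inE.
Qed.

End moran_intervals_theory.

(** * Upper limits of logarithmic ratios *)

Lemma at_right0_scale (R : realType) (k : R) : 0 < k ->
  k * x @[x --> 0^'+] --> (0 : R)^'+.
Proof.
move=> k0 P [e /= e0 H]; exists (e / k) => /=; first exact: divr_gt0.
move=> x /= xe x0; apply: H => /=; last exact: mulr_gt0.
move: xe; rewrite !sub0r !normrN !gtr0_norm//; last exact: mulr_gt0.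
by rewrite ltr_pdivlMr// mulrC.
Qed.

(** Both bounds are [f] after a positive rescaling of the variable, which does not change the limit
    at 0 from the right. *)
Lemma squeeze_at_right0 (R : realType) (f g : R -> \bar R) (k k' : R)
    (l : \bar R) : 0 < k -> 0 < k' ->
  (\forall x \near (0 : R)^'+, (f (k * x)%R <= g x <= f (k' * x)%R)%E) ->
  f x @[x --> (0 : R)^'+] --> l -> g x @[x --> (0 : R)^'+] --> l.
Proof.
move=> k0 k'0 fg fl; apply: (squeeze_cvge fg).
  exact: (@cvg_comp _ _ _ (fun x => k * x) f _ _ _ (at_right0_scale k0) fl).
exact: (@cvg_comp _ _ _ (fun x => k' * x) f _ _ _ (at_right0_scale k'0) fl).
Qed.

(** Replaces an extended real bound, such as an upper limit, by real numbers above it. *)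
Lemma lee_forall_gt (R : realType) (x y : \bar R) :
  (forall s : R, (y < s%:E)%E -> (x <= s%:E)%E) -> (x <= y)%E.
Proof.
case: y => [r||] H; last 2 first.
- exact: leey.
- case: x H => [r /(_ (r - 1))|/(_ 0)|]//.
    by rewrite ltNyr lee_fin => /(_ isT) ?; exfalso; lra.
  by rewrite ltNyr => /(_ isT).
by apply/lee_addgt0Pr => e e0; apply: H; rewrite lte_fin ltrDl.
Qed.

Section limn_esup_theory.
Context {R : realType}.
Implicit Type u : nat -> \bar R.

Lemma limn_esup_lt u x : (limn_esup u < x)%E -> \forall q \near \oo, (u q < x)%E.
Proof.
move=> /ereal_inf_lt[_ [V Voo <-] Vx]; apply: filterS Voo => q Vq.
by apply: le_lt_trans Vx; apply: ereal_sup_ubound; exists q.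
Qed.

Lemma limn_esup_le u x : (\forall q \near \oo, (u q <= x)%E) ->
  (limn_esup u <= x)%E.
Proof.
move=> ux; apply: ge_ereal_inf; exists (ereal_sup (u @` [set q | (u q <= x)%E])).
  by exists [set q | (u q <= x)%E].
by apply: ge_ereal_sup => _ [q ? <-].
Qed.

End limn_esup_theory.

(** * Logarithmic sums and the upper limit of the statement *)

Section logarithmic_sums.
Context {R : realType}.
Variables (n : nat -> nat) (c : nat -> R).
Hypothesis n_ge2 : forall k : nat, (1 <= k)%N -> (2 <= n k)%N.
Hypothesis c_bound : forall k : nat, (1 <= k)%N -> 0 < c k /\ c k <= 1 / (n k)%:R.

Definition logN k : R := ln (\prod_(1 <= i < k.+1) (n i)%:R).
Definition logC k : R := - ln (\prod_(1 <= i < k.+1) c i).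

Local Notation A := logN.
Local Notation L := logC.

Let n_gt0 k : (1 <= k)%N -> 0 < (n k)%:R :> R.
Proof. by move=> /n_ge2 n2; rewrite ltr0n (leq_trans _ n2). Qed.

Let c_gt0 k : (1 <= k)%N -> 0 < c k. Proof. by move=> /c_bound[]. Qed.

Lemma logNB p q : (p <= q)%N ->
  ln (\prod_(p.+1 <= i < q.+1) (n i)%:R) = A q - A p.
Proof.
move=> pq; rewrite /logN (@big_cat_nat _ _ _ p.+1 1 q.+1)//=.
by rewrite lnM ?posrE ?prod_nat_gt0// addrC addKr.
Qed.

Lemma logCB p q : (p <= q)%N ->
  - ln (\prod_(p.+1 <= i < q.+1) c i) = L q - L p.
Proof.
move=> pq; rewrite /logC (@big_cat_nat _ _ _ p.+1 1 q.+1)//=.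
by rewrite lnM ?posrE ?prod_nat_gt0//; lra.
Qed.

Lemma logN0 : A 0 = 0. Proof. by rewrite /logN big_geq ?ln1. Qed.
Lemma logC0 : L 0 = 0. Proof. by rewrite /logC big_geq ?ln1 ?oppr0. Qed.

Lemma logNS k : A k <= A k.+1.
Proof.
rewrite -subr_ge0 -logNB// big_nat1 ln_ge0// ler1n.
by rewrite (leq_trans _ (n_ge2 _)).
Qed.

(** Because [c k.+1 <= 1 / n k.+1 <= 1 / 2]. Hence [L] is strictly increasing and unbounded. *)
Lemma logCS k : L k + ln 2 <= L k.+1.
Proof.
rewrite -lerBrDl -logCB// big_nat1.
have [c0 cn] := c_bound (ltn0Sn k).
rewrite lerNr -lnV ?posrE// ler_ln ?posrE ?invr_gt0//.
apply: le_trans cn _; rewrite div1r lef_pV2 ?posrE ?n_gt0//.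
by rewrite ler_nat n_ge2.
Qed.

Lemma ln2_gt0 : 0 < ln 2 :> R. Proof. by rewrite ln_gt0// ltr1n. Qed.

Lemma logN_le p q : (p <= q)%N -> A p <= A q.
Proof. exact: (homo_leq (@lexx _ _) (@le_trans _ _) logNS). Qed.

Lemma logN_ge0 p : 0 <= A p.
Proof. by rewrite -logN0 logN_le. Qed.

Lemma logC_diff p q : (p <= q)%N -> (q - p)%:R * ln 2 <= L q - L p.
Proof.
elim: q => [|q IH]; first by rewrite leqn0 => /eqP ->; rewrite subrr mul0r.
rewrite leq_eqVlt => /predU1P[->|]; first by rewrite subnn subrr mul0r.
rewrite ltnS => pq; rewrite subSn// -natr1.
by have := IH pq; have := logCS q; lra.
Qed.

Lemma logC_le p q : (p <= q)%N -> L p <= L q.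
Proof.
move=> /logC_diff pq; rewrite -subr_ge0; apply: le_trans pq.
by rewrite mulr_ge0// ltW// ln2_gt0.
Qed.

Lemma logC_lt p q : (p < q)%N -> L p < L q.
Proof.
by move=> /logC_le; apply: lt_le_trans; have := logCS p; have := ln2_gt0; lra.
Qed.

Lemma logC_ge0 p : 0 <= L p.
Proof. by rewrite -logC0 logC_le. Qed.

Lemma logC_near M : \forall q \near \oo, M <= L q.
Proof.
near=> q; have := logC_diff (leq0n q); rewrite subn0 logC0 subr0.
apply: le_trans; rewrite -ler_pdivrMr ?ln2_gt0//; near: q.
exact: nbhs_infty_ger.
Unshelve. all: by end_near. Qed.

Lemma log_ratio_le p q x : (p < q)%N ->
  (log_ratio n c p.+1 q <= x) = (A q - A p <= x * (L q - L p)).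
Proof.
move=> pq; rewrite /log_ratio logNB ?logCB ?(ltnW pq)//.
by rewrite ler_pdivrMr// subr_gt0 logC_lt.
Qed.

(** The index is shifted so that the product from [p.+1] to [q] becomes a difference between levels
    [p] and [q]. An empty range is harmless: its maximum is [-oo]. *)
Lemma bigmax_log_ratio_le (P : pred nat) m q x : (m <= q)%N ->
  (\big[maxe/-oo%E]_(1 <= p < m.+1 | P p) (log_ratio n c p q)%:E <= x%:E)%E
  <-> (forall p, (p < m)%N -> P p.+1 -> A q - A p <= x * (L q - L p)).
Proof.
move=> mq; split=> [H p pm Pp|H].
  rewrite -log_ratio_le ?(leq_trans pm)// -lee_fin; apply: le_trans H.
  by apply: le_bigmax_seq => //; rewrite mem_index_iota.
rewrite big_nat_cond; apply: bigmax_le; first exact: leNye.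
case=> [|p] /andP[/andP[// _ pm] Pp].
by rewrite lee_fin log_ratio_le ?H// (leq_trans _ mq).
Qed.

Lemma ell_le q delta : (ell c q delta <= q)%N.
Proof.
apply/bigmax_leqP_seq => i; rewrite mem_index_iota => /andP[_].
by rewrite ltnS.
Qed.

(** Since [L] increases, the admissible indices form an initial segment, so being at most their
    maximum means being admissible. *)
Lemma lt_ell p q delta : (p < q)%N ->
  (p < ell c q delta)%N = (delta * L q < L q - L p).
Proof.
move=> pq; have Lq : 0 < L q by rewrite (le_lt_trans (logC_ge0 p))// logC_lt.
have condE i : (i <= q)%N ->
  (delta < ln (\prod_(i.+1 <= j < q.+1) c j) / ln (\prod_(1 <= j < q.+1) c j))
  = (delta * L q < L q - L i).
  by move=> iq; rewrite -mulrNN -invrN logCB// -/(L q) ltr_pdivlMr.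
apply/idP/idP => [|H]; last first.
  apply: (@leq_bigmax_seq _ _ _ _ p.+1); first by rewrite mem_index_iota/= ltnS.
  by rewrite condE// ltnW.
apply: contraTT; rewrite -leNgt -leqNgt => H.
apply/bigmax_leqP_seq => -[|i]//; rewrite mem_index_iota => /andP[_]; rewrite ltnS => iq.
rewrite condE ?(ltnW iq)// => H'; rewrite ltnNge; apply/negP => /logC_le.
by move: H H'; lra.
Qed.

(** The function [S] of the overview, for a fixed [delta]. *)
Definition esup_ratio (delta : R) : \bar R := limn_esup (fun q : nat =>
  \big[maxe/-oo%E]_(1 <= p < (ell c q delta).+1) (log_ratio n c p q)%:E).

Lemma esup_ratio_le delta s :
  (\forall q \near \oo, forall p, (p < q)%N -> delta * L q < L q - L p ->
     A q - A p <= s * (L q - L p)) -> (esup_ratio delta <= s%:E)%E.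
Proof.
move=> H; apply: limn_esup_le; apply: filterS H => q H.
apply/(@bigmax_log_ratio_le xpredT); first exact: ell_le.
move=> p pl _; have pq := leq_trans pl (ell_le q delta).
by apply: H => //; rewrite -lt_ell.
Qed.

Lemma esup_ratio_lt delta s : (esup_ratio delta < s%:E)%E ->
  \forall q \near \oo, forall p, (p < q)%N -> delta * L q < L q - L p ->
     A q - A p <= s * (L q - L p).
Proof.
move=> /limn_esup_lt; apply: filterS => q /ltW.
move=> /(@bigmax_log_ratio_le xpredT) H p pq h.
by apply: H => //; [exact: ell_le|rewrite lt_ell].
Qed.

Lemma esup_ratio_anti delta eps : delta <= eps ->
  (esup_ratio eps <= esup_ratio delta)%E.
Proof.
move=> de; apply: lee_forall_gt => s /esup_ratio_lt H; apply: esup_ratio_le.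
apply: filterS H => q H p pq h; apply: H => //; apply: le_lt_trans h.
by rewrite ler_wpM2r// logC_ge0.
Qed.

Lemma esup_ratio_cvg : cvg (esup_ratio delta @[delta --> (0 : R)^'+]).
Proof.
apply: nonincreasing_at_right_is_cvge; apply: nearW => x d e _ _.
exact: esup_ratio_anti.
Qed.

Section slowly_varying.
Hypothesis slow :
  ln (c k) / ln (\prod_(1 <= i < k.+1) c i) @[k --> \oo] --> (0 : R).

(** The increment is [- ln (c k.+1)], so this is the hypothesis read at [k.+1]. *)
Lemma logC_step eps : 0 < eps ->
  \forall k \near \oo, L k.+1 - L k <= eps * L k.+1.
Proof.
move=> e0.
have : \forall k \near \oo,
    ln (c k) / ln (\prod_(1 <= i < k.+1) c i) <= eps.
  move/cvgrPdist_le: slow => /(_ _ e0); apply: filterS => k.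
  by rewrite sub0r normrN; apply: le_trans; exact: ler_norm.
move=> [N _ H]; exists N => // k /= Nk; have := H k.+1 (leqW Nk).
rewrite /= -mulrNN -invrN -/(L k.+1) ler_pdivrMr; last first.
  by rewrite (le_lt_trans (logC_ge0 k))// logC_lt.
by rewrite -(logCB (leqnSn k)) big_nat1.
Qed.

End slowly_varying.
End logarithmic_sums.

(** * Comparison of exponents *)

Section quasi_assouad_moran.
Context {R : realType}.
Variables (a b : R) (n : nat -> nat) (c : nat -> R) (lo hi : seq nat -> R).
Hypothesis ab : a < b.
Hypothesis n_ge2 : forall k : nat, (1 <= k)%N -> (2 <= n k)%N.
Hypothesis c_bound : forall k : nat, (1 <= k)%N -> 0 < c k /\ c k <= 1 / (n k)%:R.
Hypothesis mor : moran_intervals a b n c lo hi.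

Let E : set R^o := \bigcap_k \bigcup_(w in words n k) basic_itv lo hi w.

Local Notation A := (logN n : nat -> R).
Local Notation L := (logC c).
Local Notation l := (level_length a b c).

Let c_gt0 k : (1 <= k)%N -> 0 < c k. Proof. by move=> /c_bound[]. Qed.

Let D0 : 0 < b - a. Proof. by rewrite subr_gt0. Qed.

Lemma level_lengthE k : l k = expR (ln (b - a) - L k).
Proof.
rewrite expRB lnK ?posrE// /logC expRN invrK lnK ?posrE//.
exact: prod_nat_gt0.
Qed.

Lemma natr_prodE p q : (p <= q)%N ->
  (\prod_(p.+1 <= i < q.+1) n i)%N%:R = expR (A q - A p) :> R.
Proof.
move=> pq; rewrite -logNB// lnK ?natr_prod// posrE; apply: prod_nat_gt0 => // k.
by move=> /n_ge2 n2; rewrite ltr0n (leq_trans _ n2).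
Qed.

Lemma covering_number_ge p q (rho r : R) : (p <= q)%N ->
  l p <= rho -> 0 <= r <= l q ->
  ((expR (A q - A p) / 4)%:E <= covering_number E r rho)%E.
Proof.
move=> pq hrho hr; apply: le_ereal_inf_tmp => _ [N H <-].
rewrite lee_fin ler_pdivrMr// -natr_prodE// -natrM ler_nat mulnC.
rewrite -(subnKC pq) in hr *.
exact: (prod_le_covered ab n_ge2 c_gt0 mor hrho hr).
Qed.

Lemma covering_number_le p q (rho r : R) : (p <= q)%N ->
  rho <= l p -> l q <= r ->
  (covering_number E r rho <= (4 * expR (A q - A p))%:E)%E.
Proof.
move=> pq hrho hr; apply: ereal_inf_lbound.
exists (4 * \prod_(p.+1 <= i < q.+1) n i)%N; last by rewrite natrM natr_prodE.
rewrite -(subnKC pq) in hr * => x Ex.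
exact: (covered_by_prod ab n_ge2 c_gt0 mor Ex hrho hr).
Qed.

(** An admissible exponent [alpha] is tested on the radii [l q] and [l p], where the number of
    descendants bounds the covering number from below. *)
Lemma esup_ratio_le_qA_exponent (delta : R) : 0 < delta < 1 ->
  (esup_ratio n c delta <= qA_exponent E (delta / 2))%E.
Proof.
move=> /andP[d0 d1]; apply: le_ereal_inf_tmp.
move=> _ [alpha [al0 [b0 [c0 [b00 c00 H]]]] <-].
apply/lee_addgt0Pr => e e0; rewrite -EFinD.
apply: (esup_ratio_le n_ge2 c_bound).
have L_near := logC_near n_ge2 c_bound.
pose lD := ln (b - a).
(* From level [p0] on, lengths are below [b0]; the [+ 1] makes this strict. *)
have [p0 _ /(_ p0 (leqnn _))/= hp0] := L_near (lD - ln b0 + 1).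
near=> q => p pq hpq.
have qp0 : (p0 <= q)%N by near: q; exists p0.
(* The exponent bound only applies to radii below [b0], so a level [p < p0] is
   replaced by [p0], at bounded cost. *)
pose p' := maxn p p0.
have pp' : (p <= p')%N by exact: leq_maxl.
have p'q : (p' <= q)%N by rewrite geq_max (ltnW pq) qp0.
(* This is the logarithm of [r ^ (1 - delta / 2) <= rho] for [r = l q] and [rho = l p']. Halving
   [delta] leaves room for [lD], the logarithm of the length of the initial interval. *)
have Lp'_le : L p' <= delta / 2 * lD + (1 - delta / 2) * L q.
  have q1 : L p0 - delta / 2 * lD <= (1 - delta / 2) * L q.
    rewrite -ler_pdivrMl; last by lra.
    by near: q; exact: L_near.
  have q2 : - lD <= L q by near: q; exact: L_near.
  have : delta / 2 * - lD <= delta / 2 * L q by rewrite ler_wpM2l//; lra.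
  by rewrite /p' /maxn; case: ifP => _; lra.
have Ap' : A p' <= A p + A p0.
  have := logN_ge0 (R:=R) n_ge2 p; have := logN_ge0 (R:=R) n_ge2 p0.
  by rewrite /p' /maxn; case: ifP => _; lra.
have LDq : lD < L q.
  have : lD + 1 <= L q by near: q; exact: L_near.
  by lra.
have lq0 : 0 < l q by rewrite level_lengthE expR_gt0.
have lnl k : ln (l k) = lD - L k by rewrite level_lengthE expRK.
have := H (l q) (l p') lq0.
rewrite /powR gt_eqF// lnl.
have -> : (l q < expR ((1 - delta / 2) * (lD - L q))).
  rewrite level_lengthE ltr_expR -/lD.
  have : 0 < delta / 2 * (L q - lD) by rewrite mulr_gt0//; lra.
  by lra.
have -> : (expR ((1 - delta / 2) * (lD - L q)) <= l p').
  by rewrite level_lengthE ler_expR -/lD; lra.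
have -> : l p' < b0.
  rewrite level_lengthE -/lD -[b0]lnK ?posrE// ltr_expR.
  have : L p0 <= L p' by apply: (logC_le n_ge2 c_bound); exact: leq_maxr.
  by lra.
move=> /(_ isT isT isT).
rewrite gt_eqF ?divr_gt0//; last by rewrite level_lengthE expR_gt0.
have -> : ln (l p' / l q) = L q - L p'.
  by rewrite !level_lengthE -expRB expRK; lra.
have lqr : 0 <= l q <= l q by rewrite lexx ltW.
move=> /(le_trans (covering_number_ge p'q (lexx _) lqr)).
rewrite lee_fin ler_pdivrMr// mulrAC -[c0 * 4]lnK ?posrE ?mulr_gt0// -expRD ler_expR.
move=> main.
(* The multiplicative constants and the cost of passing from [p] to [p'] do not depend on [q],
   whereas [L q - L p] exceeds [delta * L q], which tends to infinity. *)
have K : ln (c0 * 4) + A p0 <= e * (delta * L q).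
  rewrite mulrA -ler_pdivrMl ?mulr_gt0//.
  by near: q; exact: L_near.
have e1 : e * (delta * L q) <= e * (L q - L p) by rewrite ler_wpM2l// ltW.
have e2 : alpha * (L q - L p') <= alpha * (L q - L p).
  by rewrite ler_wpM2l// lerB// (logC_le n_ge2 c_bound).
by lra.
Unshelve. all: by end_near. Qed.

Lemma level_bracket (t : R) : 0 < t -> t < l 0 ->
  exists k, l k.+1 <= t < l k.
Proof.
move=> t0 tl0.
have exk : exists k, l k <= t.
  have [k _ /(_ k (leqnn _))/= hk] := logC_near n_ge2 c_bound (ln (b - a) - ln t).
  by exists k; rewrite level_lengthE -[t]lnK ?posrE// ler_expR; lra.
case: (ex_minnP exk) => -[|k] lk mink; first by rewrite leNgt tl0 in lk.
exists k; rewrite lk ltNge; apply/negP => /mink.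
by rewrite ltnn.
Qed.

Hypothesis slow :
  ln (c k) / ln (\prod_(1 <= i < k.+1) c i) @[k --> \oo] --> (0 : R).

(** With [rho] between levels [p.+1] and [p], and [r] between levels [q.+1] and [q], a ball is
    covered using descendants from level [p] to level [q.+1]. This rounding costs two increments of
    [L], small against [ln (rho / r)]. *)
Lemma qA_exponent_le_esup_ratio (delta : R) : 0 < delta < 1 ->
  (qA_exponent E delta <= esup_ratio n c (delta / 2))%E.
Proof.
move=> /andP[d0 d1]; apply: lee_forall_gt => s.
move=> /(esup_ratio_lt n_ge2 c_bound) Hs.
apply/lee_addgt0Pr => e e0; rewrite -EFinD.
have L_near := logC_near n_ge2 c_bound.
pose lD := ln (b - a).
(* Exponents must be nonnegative. The index [p = 0] is admissible because [delta / 2 < 1], and it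
   forces the sign of [s]. *)
have s0 : 0 <= s.
  have : \forall q \near \oo, 0 <= s.
    near=> q; have q0 : (0 < q)%N by near: q; exists 1%N.
    have Lq : 0 < L q.
      by rewrite (le_lt_trans (logC_ge0 n_ge2 c_bound 0))// (logC_lt n_ge2 c_bound).
    have h : delta / 2 * L q < L q - L 0.
      by rewrite logC0 subr0 gtr_pMl//; lra.
    have : A q - A 0 <= s * (L q - L 0) by apply: (near Hs q).
    rewrite logN0 logC0 !subr0 => /(le_trans (logN_ge0 n_ge2 q)).
    by rewrite pmulr_lge0.
  by case=> N _ /(_ N (leqnn _)).
(* With [X = ln (rho / r)], the error [2 s eps L q.+1] turns out to be at most
   [4 s eps X / delta], and this [eps] makes that at most [e X]. *)
pose eps := Num.min (4^-1) (e * delta / (4 * (s + 1))).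
have s10 : 0 < 4 * (s + 1) by lra.
have eps0 : 0 < eps by rewrite lt_min invr_gt0 ltr0n/= divr_gt0// mulr_gt0.
have eps1 : eps <= 4^-1 by rewrite ge_min lexx.
have eps2 : 4 * s * eps <= e * delta.
  have : eps <= e * delta / (4 * (s + 1)) by rewrite ge_min lexx orbT.
  rewrite ler_pdivlMr// => h.
  by apply: le_trans h; rewrite mulrC ler_wpM2l//; [exact: ltW|lra].
have [K1 _ step] := logC_step n_ge2 c_bound slow eps0.
have [K2 _ big] := L_near (4 * lD + 1).
have [K3 _ ratio] := Hs.
pose K := maxn K1 (maxn K2 K3).
apply: ereal_inf_lbound; exists (s + e) => //; split; first by rewrite addr_ge0// ltW.
(* A radius [rho] below [l K] has [p >= K], where all three eventual bounds hold; 4 is the constant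
   of [covering_number_le]. *)
exists (l K), 4; split=> //.
  by rewrite level_lengthE expR_gt0.
move=> r rho r0 rr rrho rhoK.
have rho0 : 0 < rho by apply: lt_trans r0 (lt_le_trans rr rrho).
have l_mono i j : l i < l j -> (j < i)%N.
  rewrite !level_lengthE ltr_expR => h; rewrite ltnNge; apply/negP.
  by move=> /(logC_le n_ge2 c_bound); move: h; lra.
have lK0 : l K <= l 0.
  by rewrite !level_lengthE ler_expR lerB// (logC_le n_ge2 c_bound).
have [p /andP[p1 p2]] := level_bracket rho0 (lt_le_trans rhoK lK0).
have rrho' : r < rho by exact: lt_le_trans rrho.
have [q /andP[q1 q2]] :=
  level_bracket r0 (lt_trans rrho' (lt_le_trans rhoK lK0)).
have Kp : (K <= p)%N by rewrite -ltnS; apply: l_mono; exact: le_lt_trans rhoK.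
have pq : (p <= q)%N.
  by rewrite -ltnS; apply: l_mono; apply: le_lt_trans q1 (lt_trans rrho' p2).
have Kq : (K <= q)%N := leq_trans Kp pq.
pose X := ln (rho / r).
have XE : X = ln rho - ln r by rewrite /X ln_div.
have lb k t : 0 < t -> l k <= t -> lD - L k <= ln t.
  by move=> t0; rewrite level_lengthE -{1}[t]lnK ?posrE// ler_expR.
have ub k t : 0 < t -> t < l k -> ln t < lD - L k.
  by move=> t0; rewrite level_lengthE -{1}[t]lnK ?posrE// ltr_expR.
have {p1}p1 := lb _ _ rho0 p1; have {p2}p2' := ub _ _ rho0 p2.
have q1' := lb _ _ r0 q1; have {q2}q2 := ub _ _ r0 q2.
have rhor : (1 - delta) * ln r <= ln rho.
  by move: rrho; rewrite /powR gt_eqF// -{1}[rho]lnK ?posrE// ler_expR.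
have stepq : L q.+1 - L q <= eps * L q.+1.
  by apply: step => /=; rewrite (leq_trans _ Kq)// leq_maxl.
have stepp : L p.+1 - L p <= eps * L p.+1.
  by apply: step => /=; rewrite (leq_trans _ Kp)// leq_maxl.
have bigq : 4 * lD + 1 <= L q.+1.
  apply: big => /=; apply: leqW; apply: leq_trans Kq.
  by rewrite leq_max leq_max leqnn orbT.
have Lq0 := logC_ge0 n_ge2 c_bound q.+1.
have Lpq : L p.+1 <= L q.+1 by apply: (logC_le n_ge2 c_bound).
have eL : eps * L p.+1 <= eps * L q.+1 by rewrite ler_wpM2l// ltW.
have eL4 : eps * L q.+1 <= 4^-1 * L q.+1 by rewrite ler_wpM2r.
(* From [rho >= r ^ (1 - delta)] one gets [X >= delta * (- ln r)]. Moreover [- ln r] is at least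
   [3 / 4 * L q.+1 - lD], and [lD] is less than a quarter of [L q.+1]. *)
have X1 : delta / 2 * L q.+1 < X.
  have : delta * (3 / 4 * L q.+1 - lD) <= delta * (- ln r).
    by rewrite ler_wpM2l ?(ltW d0)//; lra.
  have : 0 < delta * (4^-1 * L q.+1 - lD) by rewrite mulr_gt0//; lra.
  by lra.
(* Rounding outwards only widens the gap, so the pair [p], [q.+1] is admissible for [delta / 2]. *)
have X2 : X <= L q.+1 - L p by lra.
have := ratio q.+1 _ p _ (lt_le_trans X1 X2).
have K3q : (K3 <= q.+1)%N.
  by apply: leqW; apply: leq_trans Kq; rewrite !leq_max leqnn !orbT.
move=> /(_ K3q pq) Apq.
apply: le_trans (covering_number_le (leqW pq) (ltW _) q1) _.
  by rewrite level_lengthE -[rho]lnK ?posrE// ltr_expR.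
rewrite lee_fin ler_pM2l// /powR gt_eqF ?divr_gt0// ler_expR -/X.
apply: le_trans Apq _.
have h1 : s * (L q.+1 - L p) <= s * (X + 2 * (eps * L q.+1)).
  by rewrite ler_wpM2l//; lra.
have h2 : 4 * s * eps * (delta / 2 * L q.+1) <= 4 * s * eps * X.
  by rewrite ler_wpM2l ?(ltW X1)// !mulr_ge0// ltW.
have X0 : 0 <= X by apply: le_trans (ltW X1); rewrite mulr_ge0//; lra.
have h3 : 4 * s * eps * X <= e * delta * X by rewrite ler_wpM2r.
have h4 : delta * (s * (2 * (eps * L q.+1))) <= delta * (e * X) by lra.
rewrite ler_pM2l// in h4.
by lra.
Unshelve. all: by end_near. Qed.

Lemma esup_ratio_cvg_dim_qA :
  esup_ratio n c delta @[delta --> (0 : R)^'+] --> dim_qA E.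
Proof.
have /cvg_ex[d Sd] := esup_ratio_cvg n_ge2 c_bound.
suff hd : qA_exponent E delta @[delta --> (0 : R)^'+] --> d.
  by rewrite /dim_qA (cvg_lim _ hd).
(* The two comparisons read [S (2 * x) <= h x <= S (x / 2)] for small [x]. *)
apply: (@squeeze_at_right0 _ _ _ 2 (2^-1) _ _ _ _ Sd) => //.
near=> x.
have x0 : 0 < x by near: x; exact: nbhs_right_gt.
have x1 : x < 2^-1 by near: x; apply: nbhs_right_lt; rewrite invr_gt0.
rewrite [2^-1 * x]mulrC; apply/andP; split.
  have := @esup_ratio_le_qA_exponent (2 * x).
  by rewrite [2 * x]mulrC mulfK//; apply; lra.
by apply: qA_exponent_le_esup_ratio; lra.
Unshelve. all: by end_near. Qed.

End quasi_assouad_moran.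

(** * Contraction ratios bounded away from 0 *)

Section bounded_ratios.
Context {R : realType}.
Variables (n : nat -> nat) (c : nat -> R).
Hypothesis n_ge2 : forall k : nat, (1 <= k)%N -> (2 <= n k)%N.
Hypothesis c_bound : forall k : nat, (1 <= k)%N -> 0 < c k /\ c k <= 1 / (n k)%:R.
Variable kappa : R.
Hypothesis kappa_gt0 : 0 < kappa.
Hypothesis kappa_le : forall k : nat, (1 <= k)%N -> kappa <= c k.

Local Notation A := (logN n : nat -> R).
Local Notation L := (logC c).

Let M := - ln kappa.

Lemma logC_step_le k : L k.+1 <= L k + M.
Proof.
rewrite -lerBlDl -(logCB c_bound (leqnSn k)) big_nat1 lerN2.
by rewrite ler_ln ?posrE ?kappa_le//; have [] := c_bound (ltn0Sn k).
Qed.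

Lemma logC_diff_le p q : (p <= q)%N -> L q - L p <= (q - p)%:R * M.
Proof.
elim: q => [|q IH]; first by rewrite leqn0 => /eqP ->; rewrite subrr mul0r.
rewrite leq_eqVlt => /predU1P[->|]; first by rewrite subnn subrr mul0r.
rewrite ltnS => pq; rewrite subSn// -natr1.
by have := IH pq; have := logC_step_le q; lra.
Qed.

(** Compares the two bounds on the first increment of [L]; it makes [M] positive. *)
Lemma ln2_le : ln 2 <= M.
Proof. by have := logCS n_ge2 c_bound 0; have := logC_step_le 0; lra. Qed.

(** The numerator is at most [M] in absolute value, while [L k] tends to infinity. *)
Lemma bounded_slow :
  ln (c k) / ln (\prod_(1 <= i < k.+1) c i) @[k --> \oo] --> (0 : R).
Proof.
apply/cvgrPdist_le => e e0; near=> k; rewrite sub0r normrN.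
have k0 : (0 < k)%N by near: k; exists 1%N.
have hL : M / e <= L k by near: k; exact: (logC_near n_ge2 c_bound).
have [ck0 _] := c_bound k0.
have /andP[hc1 hc2] : 0 <= - ln (c k) <= M.
  rewrite /M lerN2 ler_ln ?posrE// kappa_le// andbT.
  have := logCS n_ge2 c_bound k.-1; have := @ln2_gt0 R.
  have := logCB c_bound (leqnSn k.-1); rewrite prednK// big_nat1.
  by lra.
have Lk : 0 < L k.
  by rewrite (le_lt_trans (logC_ge0 n_ge2 c_bound 0))// (logC_lt n_ge2 c_bound).
rewrite -mulrNN -invrN -/(L k) ger0_norm; last by rewrite divr_ge0// ltW.
rewrite ler_pdivrMr//; rewrite ler_pdivrMr// in hL; lra.
Unshelve. all: by end_near. Qed.

Definition esup_ratio_linear (eta : R) : \bar R := limn_esup (fun q : nat =>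
  \big[maxe/-oo%E]_(1 <= p < q.+1 | p%:R <= q%:R * (1 - eta))
    (log_ratio n c p q)%:E).

(** A gap [q - p >= q * eta + 1] makes [L q - L p] at least [ln 2] times as large, while
    [L q <= q * M]. The [+ 1], due to the index shift, yields the strict inequality. *)
Lemma esup_ratio_linear_le eta : 0 < eta ->
  (esup_ratio_linear eta <= esup_ratio n c (ln 2 / M / 2 * eta)%R)%E.
Proof.
move=> eta0; apply: lee_forall_gt => s /(esup_ratio_lt n_ge2 c_bound) H.
apply: limn_esup_le; apply: filterS H => q H.
apply/(bigmax_log_ratio_le n_ge2 c_bound) => // p pq hp; apply: H => //.
have l2 := @ln2_gt0 R; have lM := ln2_le; have M0 : 0 < M by lra.
have d1 := logC_diff n_ge2 c_bound (ltnW pq).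
have d2 := logC_diff_le (leq0n q); rewrite subn0 logC0 subr0 in d2.
have hq : q%:R * eta + 1 <= (q - p)%:R.
  by move: hp; rewrite natrB ?(ltnW pq)// -natr1; lra.
have h1 : (q%:R * eta + 1) * ln 2 <= (q - p)%:R * ln 2.
  by rewrite ler_wpM2r// ltW.
have k0 : 0 <= ln 2 / M / 2 * eta by rewrite !mulr_ge0// ?invr_ge0 ltW.
have h2 : ln 2 / M / 2 * eta * L q <= ln 2 / M / 2 * eta * (q%:R * M).
  by rewrite ler_wpM2l.
have h3 : ln 2 / M / 2 * eta * (q%:R * M) = ln 2 / 2 * eta * q%:R.
  by field; rewrite gt_eqF.
have h4 : 0 <= q%:R * eta * ln 2 by rewrite !mulr_ge0// ltW.
by lra.
Qed.

(** Conversely, [(q - p) * M >= L q - L p > delta * L q >= delta * q * ln 2]. *)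
Lemma esup_ratio_le_linear delta : 0 < delta ->
  (esup_ratio n c delta <= esup_ratio_linear (ln 2 / M / 2 * delta)%R)%E.
Proof.
move=> d0; apply: lee_forall_gt => s /limn_esup_lt H.
apply: (esup_ratio_le n_ge2 c_bound).
have l2 := @ln2_gt0 R; have lM := ln2_le; have M0 : 0 < M by lra.
near=> q => p pq hp.
have : (\big[maxe/-oo%E]_(1 <= p < q.+1 |
      (p%:R <= q%:R * (1 - ln 2 / M / 2 * delta))%R)
    (log_ratio n c p q)%:E < s%:E)%E by near: q.
move=> /ltW/(bigmax_log_ratio_le n_ge2 c_bound _ _ (leqnn q)); apply=> //.
have d1 := logC_diff_le (ltnW pq).
have d2 := logC_diff n_ge2 c_bound (leq0n q); rewrite subn0 logC0 subr0 in d2.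
have h1 : delta * (q%:R * ln 2) <= delta * L q by rewrite ler_wpM2l// ltW.
have h2 : ln 2 / M * delta * q%:R <= (q - p)%:R.
  by rewrite -(ler_pM2r M0) (_ : _ * M = delta * (q%:R * ln 2)); [lra|
     field; rewrite gt_eqF].
rewrite natrB ?(ltnW pq)// in h2.
(* For large [q] the unit lost in the index shift is at most half of the bound [h2]; hence the
   factor 1/2 in the rescaling. *)
have h3 : 2 <= ln 2 / M * delta * q%:R.
  rewrite -ler_pdivrMl; last by rewrite mulr_gt0// divr_gt0.
  by near: q; exact: nbhs_infty_ger.
by rewrite -natr1; lra.
Unshelve. all: by end_near. Qed.

Lemma esup_ratio_linear_cvg (d : \bar R) :
  esup_ratio n c delta @[delta --> (0 : R)^'+] --> d ->
  esup_ratio_linear eta @[eta --> (0 : R)^'+] --> d.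
Proof.
have l2 := @ln2_gt0 R; have lM := ln2_le; have M0 : 0 < M by lra.
pose k := ln 2 / M / 2; have k0 : 0 < k by rewrite !divr_gt0.
(* The second comparison is used at [delta = k^-1 * x], which turns its rescaled argument back into
   [x]. *)
apply: (@squeeze_at_right0 _ _ _ k^-1 k); rewrite ?invr_gt0//.
near=> x; have x0 : 0 < x by near: x; exact: nbhs_right_gt.
rewrite esup_ratio_linear_le// andbT.
have := @esup_ratio_le_linear (k^-1 * x).
by rewrite mulVKf ?gt_eqF//; apply; rewrite mulr_gt0// invr_gt0.
Unshelve. all: by end_near. Qed.

End bounded_ratios.

Theorem theorem1 (R : realType) (a b : R) (n : nat -> nat) (c : nat -> R)
    (ab : a < b)
    (n_ge2 : forall k : nat, (1 <= k)%N -> (2 <= n k)%N)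
    (c_bound : forall k : nat, (1 <= k)%N -> 0 < c k /\ c k <= 1 / (n k)%:R) :
  (ln (c k) / ln (\prod_(1 <= i < k.+1) c i) @[k --> \oo] --> (0 : R) ->
   forall E : set R^o, moran_class a b n c E ->
     limn_esup (fun q : nat =>
       \big[maxe/-oo%E]_(1 <= p < (ell c q delta).+1) (log_ratio n c p q)%:E)
     @[delta --> (0 : R)^'+] --> dim_qA E) /\
  (0 < inf [set c k | k in [set k : nat | (1 <= k)%N]] ->
   forall E : set R^o, moran_class a b n c E ->
     limn_esup (fun q : nat =>
       \big[maxe/-oo%E]_(1 <= p < q.+1 | p%:R <= q%:R * (1 - eta))
         (log_ratio n c p q)%:E)
     @[eta --> (0 : R)^'+] --> dim_qA E).
Proof.
split=> [slow E [lo [hi [mor ->]]]|inf_gt0 E [lo [hi [mor ->]]]].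
  exact: (esup_ratio_cvg_dim_qA ab n_ge2 c_bound mor slow).
(* The positive infimum plays the part of [kappa]; it is a lower bound because the [c k] are bounded
   below by 0. *)
have inf_le k : (1 <= k)%N -> inf [set c k | k in [set k | (1 <= k)%N]] <= c k.
  move=> k1; apply: ge_inf; last by exists k.
  by exists 0 => _ [j /= j1 <-]; apply: ltW; have [] := c_bound j j1.
apply: (esup_ratio_linear_cvg n_ge2 c_bound inf_gt0 inf_le).
apply: (esup_ratio_cvg_dim_qA ab n_ge2 c_bound mor).
exact: (bounded_slow n_ge2 c_bound inf_gt0 inf_le).
Qed.
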